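(* Let $(M,g_L,\nabla^Lu,\lambda,\rho)$ be a gradient Lyra almost Ricci--Bourguignon soliton on a Lyra twisted warped product $M=M_1\times_fM_2$ of dimension $n$ such that $(M,g_L)$ is a compact, connected, oriented Riemannian manifold without boundary. Then the following cases are impossible: (1) $(1-n\rho)R^L\le0$ and $\lambda>0$ on $M$; (2) $(1-n\rho)R^L\ge0$ and $\lambda<0$ on $M$.
   Context: Lyra twisted warped product: $(M_1,g_1),(M_2,g_2)$ are smooth (pseudo-)Riemannian manifolds of positive dimensions $n_1,n_2$, $n=n_1+n_2$; $f,\varphi:M_1\times M_2\to(0,\infty)$ are smooth; $M=M_1\times M_2$ carries $g=g_1\oplus f^2g_2$ and $g_L=\varphi^2g$. $\operatorname{Ric}^L,R^L,\operatorname{Hess}^L$ are the Ricci tensor, scalar curvature and Hessian of $g_L$, and $\nabla^Lu$ is the $g_L$-gradient of $u$. A gradient Lyra almost Ricci--Bourguignon soliton consists of $u,\lambda\in C^\infty(M)$, $\rho\in\mathbb R$ with $\operatorname{Ric}^L+\operatorname{Hess}^Lu=(\lambda+\rho R^L)g_L$. *)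

(* Defs.v *)
From HB Require Import structures.
From mathcomp Require Import all_boot all_order all_algebra.
From mathcomp Require Import all_classical all_reals all_analysis.

Set Implicit Arguments.
Unset Strict Implicit.
Unset Printing Implicit Defensive.

Import Order.TTheory GRing.Theory Num.Theory.
Import numFieldNormedType.Exports.

Local Open Scope classical_set_scope.
Local Open Scope ring_scope.

Section SmoothFunctions.
Context {R : realType} {n : nat}.
Implicit Types (U : set 'rV[R]_n) (h : 'rV[R]_n -> R).

Definition partial (a : 'I_n) h : 'rV[R]_n -> R :=
  fun x => 'D_(delta_mx 0 a) h x.

Fixpoint diff_upto (k : nat) U h : Prop :=
  (forall x, U x -> differentiable h x) /\
  (if k is k'.+1 then forall a, diff_upto k' U (partial a h) else True).

Lemma diff_upto0 k U : diff_upto k U (cst 0).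
Proof.
elim: k => [|k IHk]; split => // a.
suff -> : partial a (cst 0) = cst 0 by [].
by apply/funext => x; rewrite /partial derive_cst.
Qed.

(* All iterated partial derivatives exist and are (Frechet) differentiable on
   U; on an open set U this is the usual C^oo condition. *)
Definition smooth_on U h : Prop := forall k, diff_upto k U h.

End SmoothFunctions.

Section SmoothBlocks.
Context {R : realType} {n1 n2 : nat}.
Implicit Types (U : set 'rV[R]_(n1 + n2)).

Lemma derive_comp_linear n m (L : {linear 'rV[R]_n -> 'rV[R]_m})
    (h : 'rV[R]_m -> R) x v :
  'D_v (h \o L) x = 'D_(L v) h (L x).
Proof.
rewrite /derive; set F := (X in lim (X @ _) = _).
rewrite (_ : F = fun t => t^-1 *: ((h \o shift (L x)) (t *: L v) - h (L x)))//.
by apply/funext => t; rewrite /F /= (linearD L) (linearZ_LR L).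
Qed.

Lemma diff_upto_lsubmx k U (V : set 'rV[R]_n1) h :
  U `<=` lsubmx @^-1` V -> diff_upto k V h -> diff_upto k U (h \o lsubmx).
Proof.
move=> UV; elim: k h => [|k IHk] h [dh hk].
  split=> // x /UV/dh; apply: differentiable_comp.
  exact: differentiable_lsubmx.
split=> [x /UV/dh|a].
  by apply: differentiable_comp; exact: differentiable_lsubmx.
case: (splitP a) => b ab.
  suff -> : partial a (h \o lsubmx) = partial b h \o lsubmx by apply: IHk; exact: hk.
  apply/funext => x; rewrite /partial derive_comp_linear /=.
  rewrite (_ : lsubmx (delta_mx 0 a) = delta_mx 0 b)//; apply/rowP => j; rewrite !mxE eqxx /=.
  by rewrite -!val_eqE /= ab.
suff -> : partial a (h \o lsubmx) = cst 0 by exact: diff_upto0.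
apply/funext => x; rewrite /partial derive_comp_linear /=.
rewrite (_ : lsubmx (delta_mx 0 a) = 0) ?derive0//; apply/rowP => j; rewrite !mxE.
by rewrite eqxx -val_eqE /= ab ltn_eqF ?ltn_addr.
Qed.

Lemma diff_upto_rsubmx k U (V : set 'rV[R]_n2) h :
  U `<=` rsubmx @^-1` V -> diff_upto k V h -> diff_upto k U (h \o rsubmx).
Proof.
move=> UV; elim: k h => [|k IHk] h [dh hk].
  split=> // x /UV/dh; apply: differentiable_comp.
  exact: differentiable_rsubmx.
split=> [x /UV/dh|a].
  by apply: differentiable_comp; exact: differentiable_rsubmx.
case: (splitP a) => b ab; last first.
  suff -> : partial a (h \o rsubmx) = partial b h \o rsubmx by apply: IHk; exact: hk.
  apply/funext => x; rewrite /partial derive_comp_linear /=.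
  rewrite (_ : rsubmx (delta_mx 0 a) = delta_mx 0 b)//; apply/rowP => j; rewrite !mxE eqxx /=.
  by rewrite -!val_eqE /= ab eqn_add2l.
suff -> : partial a (h \o rsubmx) = cst 0 by exact: diff_upto0.
apply/funext => x; rewrite /partial derive_comp_linear /=.
rewrite (_ : rsubmx (delta_mx 0 a) = 0) ?derive0//; apply/rowP => j; rewrite !mxE.
by rewrite eqxx -val_eqE /= ab gtn_eqF ?ltn_addr.
Qed.

End SmoothBlocks.

(* The values of [coords] outside [dom] and of [param] outside
   [coords @` dom] are irrelevant. *)
Record chart (R : realType) (T : topologicalType) (n : nat) := Chart {
  dom : set T;
  coords : T -> 'rV[R]_n;
  param : 'rV[R]_n -> T;
  dom_open : open dom;
  codom_open : open (coords @` dom);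
  coordsK : forall p, dom p -> param (coords p) = p;
  coords_cont : forall p, dom p -> {for p, continuous coords};
  param_cont : forall x, (coords @` dom) x -> {for x, continuous param} }.

(* Second countable Hausdorff smooth manifolds without boundary (charts have
   open images in R^n), given by a smooth atlas, not necessarily maximal. *)
Record manifold (R : realType) (n : nat) := Manifold {
  pts :> topologicalType;
  chart_idx : Type;
  atlas : chart_idx -> chart R pts n;
  atlas_cover : forall p : pts, exists i, dom (atlas i) p;
  atlas_smooth : forall i j (a : 'I_n),
    smooth_on (coords (atlas i) @` (dom (atlas i) `&` dom (atlas j)))
              (fun x => coords (atlas j) (param (atlas i) x) 0 a);
  manifold_nonempty : [set: pts] !=set0;
  manifold_hausdorff : hausdorff_space pts;
  manifold_second_countable : @second_countable pts }.

Section ProductManifold.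
Context {R : realType}.

Section ProductChart.
Context {T1 T2 : topologicalType} {n1 n2 : nat}.
Variables (c1 : chart R T1 n1) (c2 : chart R T2 n2).

Definition prod_dom : set (T1 * T2) := dom c1 `*` dom c2.
Definition prod_coords (p : T1 * T2) : 'rV[R]_(n1 + n2) :=
  row_mx (coords c1 p.1) (coords c2 p.2).
Definition prod_param (x : 'rV[R]_(n1 + n2)) : T1 * T2 :=
  (param c1 (lsubmx x), param c2 (rsubmx x)).

Lemma prod_dom_open : open prod_dom.
Proof.
rewrite openE => p [d1 d2].
by exists (dom c1, dom c2) => //; split => /=; apply: open_nbhs_nbhs; split => //;
  exact: dom_open.
Qed.
Lemma prod_codom_open : open (prod_coords @` prod_dom).
Proof.
have -> : prod_coords @` prod_dom =
    lsubmx @^-1` (coords c1 @` dom c1) `&` rsubmx @^-1` (coords c2 @` dom c2).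
  apply/seteqP; split => [_ [p [d1 d2] <-]|x [[p d1 e1] [q d2 e2]]].
    by split => /=; [exists p.1; rewrite // row_mxKl | exists p.2; rewrite // row_mxKr].
  by exists (p, q); [split | rewrite /prod_coords /= e1 e2 hsubmxK].
apply: openI; apply: open_comp => [x _|];
  [exact: continuous_lsubmx|exact: codom_open|exact: continuous_rsubmx|exact: codom_open].
Qed.
Lemma prod_coordsK p : prod_dom p -> prod_param (prod_coords p) = p.
Proof.
case: p => p q [/= d1 d2].
by rewrite /prod_param /prod_coords row_mxKl row_mxKr /= !coordsK.
Qed.
Lemma prod_coords_cont p : prod_dom p -> {for p, continuous prod_coords}.
Proof.
case: p => p q [/= d1 d2]; apply/cvg_ballP => e e0.
have /cvg_ballP/(_ e e0) h1 := coords_cont d1.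
have /cvg_ballP/(_ e e0) h2 := coords_cont d2.
exists ([set u | ball (coords c1 p) e (coords c1 u)],
        [set v | ball (coords c2 q) e (coords c2 v)]); first by split.
move=> [u v] [/= [_ Hu] [_ Hv]]; split => // i j; rewrite !mxE.
by case: splitP => k _; [exact: Hu | exact: Hv].
Qed.
Lemma prod_param_cont x :
  (prod_coords @` prod_dom) x -> {for x, continuous prod_param}.
Proof.
move=> [[p q] [/= d1 d2] <-].
have c1x : {for lsubmx (prod_coords (p, q)), continuous (param c1)}.
  by apply: param_cont; rewrite /prod_coords row_mxKl; exists p.
have c2x : {for rsubmx (prod_coords (p, q)), continuous (param c2)}.
  by apply: param_cont; rewrite /prod_coords row_mxKr; exists q.
set x0 := prod_coords (p, q) in c1x c2x *.
have l1 : {for x0, continuous (param c1 \o lsubmx)}.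
  by apply: continuous_comp c1x; exact: continuous_lsubmx.
have l2 : {for x0, continuous (param c2 \o rsubmx)}.
  by apply: continuous_comp c2x; exact: continuous_rsubmx.
exact: cvg_pair l1 l2.
Qed.

Definition prod_chart : chart R (T1 * T2)%type (n1 + n2) :=
  Chart prod_dom_open prod_codom_open prod_coordsK prod_coords_cont
        prod_param_cont.

End ProductChart.
Context {n1 n2 : nat}.
Variables (M1 : manifold R n1) (M2 : manifold R n2).

Definition prod_index : Type := (chart_idx M1 * chart_idx M2)%type.
Definition prod_atlas (i : prod_index) : chart R (M1 * M2)%type (n1 + n2) :=
  prod_chart (atlas i.1) (atlas i.2).

Lemma prod_cover (p : M1 * M2) : exists i, dom (prod_atlas i) p.
Proof.
have [i1 d1] := atlas_cover p.1; have [i2 d2] := atlas_cover p.2.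
by exists (i1, i2).
Qed.

Lemma prod_smooth i j (a : 'I_(n1 + n2)) :
  smooth_on (coords (prod_atlas i) @`
               (dom (prod_atlas i) `&` dom (prod_atlas j)))
            (fun x => coords (prod_atlas j) (param (prod_atlas i) x) 0 a).
Proof.
move=> k; case: (splitP a) => b ab.
  have -> : (fun x => coords (prod_atlas j) (param (prod_atlas i) x) 0 a) =
      (fun y => coords (atlas j.1) (param (atlas i.1) y) 0 b) \o lsubmx.
    apply/funext => x; rewrite (_ : a = lshift n2 b); last exact/val_inj.
    exact: row_mxEl.
  apply: (diff_upto_lsubmx _ (atlas_smooth i.1 j.1 b k)).
  move=> _ [p [[d1 d2] [d1' d2']] <-] /=.
  by exists p.1 => //; rewrite row_mxKl.
have -> : (fun x => coords (prod_atlas j) (param (prod_atlas i) x) 0 a) =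
    (fun y => coords (atlas j.2) (param (atlas i.2) y) 0 b) \o rsubmx.
  apply/funext => x; rewrite (_ : a = rshift n1 b); last exact/val_inj.
  exact: row_mxEr.
apply: (diff_upto_rsubmx _ (atlas_smooth i.2 j.2 b k)).
move=> _ [p [[d1 d2] [d1' d2']] <-] /=.
by exists p.2 => //; rewrite row_mxKr.
Qed.

Lemma prod_nonempty : [set: M1 * M2] !=set0.
Proof.
have [p _] := manifold_nonempty M1; have [q _] := manifold_nonempty M2.
by exists (p, q).
Qed.
Lemma prod_hausdorff : hausdorff_space (M1 * M2)%type.
Proof.
move=> [p1 p2] [q1 q2] clpq; congr (_, _).
  apply: (@manifold_hausdorff _ _ M1) => A B pA qB.
  have pA' : nbhs (p1, p2) (fst @^-1` A) by exact: cvg_fst.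
  have qB' : nbhs (q1, q2) (fst @^-1` B) by exact: cvg_fst.
  by have [[x y] [/= Ax Bx]] := clpq _ _ pA' qB'; exists x.
apply: (@manifold_hausdorff _ _ M2) => A B pA qB.
have pA' : nbhs (p1, p2) (snd @^-1` A) by exact: cvg_snd.
have qB' : nbhs (q1, q2) (snd @^-1` B) by exact: cvg_snd.
by have [[x y] [/= Ax Bx]] := clpq _ _ pA' qB'; exists y.
Qed.
Lemma prod_second_countable : @second_countable (M1 * M2)%type.
Proof.
have [B1 cB1 [oB1 bB1]] := manifold_second_countable M1.
have [B2 cB2 [oB2 bB2]] := manifold_second_countable M2.
exists ((fun U : set M1 * set M2 => U.1 `*` U.2) @` (B1 `*` B2)).
  by apply: (sub_countable (card_image_le _ _)); exact: countableX.
split=> [_ [[U V] [/= BU BV] <-]|[x y] A [[U V] [/= xU yV] UVA]].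
  rewrite openE => p [/= pU pV]; exists (U, V) => //.
  by split; apply: open_nbhs_nbhs; split => //; [exact: oB1|exact: oB2].
have [U' [BU' U'x] U'U] := bB1 _ _ xU; have [V' [BV' V'y] V'V] := bB2 _ _ yV.
exists (U' `*` V') => /=; first by split; [exists (U', V')|].
by move=> z [/U'U ? /V'V ?]; apply: UVA.
Qed.

Definition prod_manifold : manifold R (n1 + n2) :=
  Manifold prod_cover prod_smooth prod_nonempty prod_hausdorff
           prod_second_countable.

End ProductManifold.

Section ScalarFunctions.
Context {R : realType} {n : nat} {M : manifold R n}.
Implicit Types (i j : chart_idx M) (h : M -> R).

Definition smooth_in i h : Prop :=
  smooth_on (coords (atlas i) @` dom (atlas i)) (h \o param (atlas i)).

Definition smooth_fun h : Prop := forall i, smooth_in i h.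

(* The derivative of h along the a-th coordinate vector field of chart i. *)
Definition pd i (a : 'I_n) h : M -> R :=
  fun p => partial a (h \o param (atlas i)) (coords (atlas i) p).

(* Entry (a, b) is dy^b/dx^a, for x the coordinates of chart i and y those of
   chart j. *)
Definition transition_mx i j (p : M) : 'M[R]_n :=
  \matrix_(a, b) pd i a (fun q => coords (atlas j) q 0 b) p.

End ScalarFunctions.

(* An orientation of every tangent space: [o i p] tells whether the coordinate
   frame of chart i at p is positively oriented. *)
Definition orientation (R : realType) (n : nat) (M : manifold R n)
    (o : chart_idx M -> M -> bool) : Prop :=
  (forall i p, dom (atlas i) p -> \forall q \near p, o i q = o i p) /\
  (forall i j p, dom (atlas i) p -> dom (atlas j) p ->
     o i p (+) o j p = (\det (transition_mx i j p) < 0)).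

Section Tensors.
Context {R : realType} {n : nat}.

(* A covariant 2-tensor field, given by its component matrix in each chart
   (indexed by the atlas) at each point of the domain of the chart. *)
Definition tensor2 (M : manifold R n) : Type := chart_idx M -> M -> 'M[R]_n.

Context {M : manifold R n}.
Implicit Types (g : tensor2 M) (i j : chart_idx M) (p : M) (a b c d k : 'I_n).

Record pseudo_riemannian g : Prop := PseudoRiemannian {
  metric_sym : forall i p, dom (atlas i) p -> (g i p)^T = g i p;
  metric_nondegenerate : forall i p, dom (atlas i) p -> g i p \in unitmx;
  metric_smooth : forall i a b, smooth_in i (fun p => g i p a b);
  metric_tensorial : forall i j p, dom (atlas i) p -> dom (atlas j) p ->
    g i p = transition_mx i j p *m g j p *m (transition_mx i j p)^T }.

Definition positive_definite g : Prop :=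
  forall i p, dom (atlas i) p ->
    forall v : 'rV[R]_n, v != 0 -> 0 < (v *m g i p *m v^T) 0 0.

Definition riemannian g : Prop := pseudo_riemannian g /\ positive_definite g.

(* Gamma^k_ab of the Levi-Civita connection. *)
Definition christoffel g i k a b : M -> R := fun p =>
  2^-1 * \sum_d invmx (g i p) k d *
    (pd i a (fun q => g i q d b) p + pd i b (fun q => g i q a d) p
     - pd i d (fun q => g i q a b) p).

(* The k-th component of R(d_a, d_b)d_c, where
   R(X, Y) = [nabla_X, nabla_Y] - nabla_[X, Y]. *)
Definition riemann g i k a b c : M -> R := fun p =>
  pd i a (christoffel g i k b c) p - pd i b (christoffel g i k a c) p
  + \sum_d (christoffel g i k a d p * christoffel g i d b c p
            - christoffel g i k b d p * christoffel g i d a c p).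

(* Ric(Y, Z) = tr (X |-> R(X, Y)Z), positive on round spheres. *)
Definition ricci g : tensor2 M := fun i p =>
  \matrix_(b, c) \sum_a riemann g i a a b c p.

Definition scal g i p : R := \tr (invmx (g i p) *m ricci g i p).

(* nabla du *)
Definition hessian g (u : M -> R) : tensor2 M := fun i p =>
  \matrix_(a, b) (pd i a (pd i b u) p
                  - \sum_k christoffel g i k a b p * pd i k u p).

(* The soliton (M, g, grad u, lambda, rho). *)
Record gradient_almost_RB_soliton g (u lambda : M -> R) (rho : R) : Prop :=
  GradientAlmostRBSoliton {
  potential_smooth : smooth_fun u;
  soliton_fun_smooth : smooth_fun lambda;
  soliton_eq : forall i p, dom (atlas i) p ->
    ricci g i p + hessian g u i p = (lambda p + rho * scal g i p) *: g i p }.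

End Tensors.

Section LyraTwistedProduct.
Context {R : realType} {n1 n2 : nat} {M1 : manifold R n1} {M2 : manifold R n2}.
Variables (g1 : tensor2 M1) (g2 : tensor2 M2).
Variables f phi : prod_manifold M1 M2 -> R.

Definition twisted_metric : tensor2 (prod_manifold M1 M2) := fun i p =>
  block_mx (g1 i.1 p.1) 0 0 (f p ^+ 2 *: g2 i.2 p.2).

Definition lyra_metric : tensor2 (prod_manifold M1 M2) := fun i p =>
  phi p ^+ 2 *: twisted_metric i p.

End LyraTwistedProduct.

(* Main.v *)
(* Taking the g_L-trace of the soliton equation gives
   Delta u = n lambda - (1 - n rho) R^L, which is everywhere positive in case (1)
   and everywhere negative in case (2). On a compact manifold u attains its
   maximum and its minimum; there the gradient vanishes, so the Christoffel terms
   of the Hessian drop out and the second derivative test forces Delta u <= 0,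
   resp. Delta u >= 0. No integration over M is involved. *)
Require Import Defs.
From mathcomp Require Import all_boot all_order all_algebra.
From mathcomp Require Import all_classical all_reals all_analysis.
From mathcomp Require Import ring.

Set Implicit Arguments.
Unset Strict Implicit.
Unset Printing Implicit Defensive.

Import Order.TTheory GRing.Theory Num.Theory.
Import numFieldNormedType.Exports.

Local Open Scope classical_set_scope.
Local Open Scope ring_scope.

(** * Derivative tests in one real variable *)

Lemma derivative0_at_local_max (R : realType) (h dh : R -> R) :
  (\forall t \near (0 : R), is_derive t (1 : R) h (dh t)) ->
  (\forall t \near (0 : R), h t <= h 0) -> dh 0 = 0.
Proof.
move=> hd hmax; have /nbhs_ballP[e /= e0 He] :
    nbhs (0 : R) [set t | is_derive t (1 : R) h (dh t) /\ h t <= h 0].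
  exact: filterI hd hmax.
have inb t : t \in `]- e, e[%R -> ball 0 e t.
  by rewrite in_itv /= /ball /= sub0r normrN ltr_norml.
have d0 : is_derive (0 : R) 1 h (dh 0) by exact: (He _ (ballxx _ e0)).1.
have [|t /inb /He[]//||t /inb /He[]//|] := @derive1_at_max _ h (- e) e 0.
- by rewrite (@le_trans _ _ 0) ?oppr_le0// ltW.
- by rewrite in_itv /= oppr_lt0 e0.
by move=> _; rewrite (@derive_val _ _ _ _ _ _ _ d0).
Qed.

(** Since [dh 0 = 0], a positive [d2h] would make [dh] positive just to the right of 0, and the mean
    value theorem would then give a value of [h] above [h 0]. *)
Lemma second_derivative_le0_at_local_max (R : realType) (h dh : R -> R) (d2h : R) :
  (\forall t \near (0 : R), is_derive t (1 : R) h (dh t)) -> is_derive (0 : R) 1 dh d2h ->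
  (\forall t \near (0 : R), h t <= h 0) -> d2h <= 0.
Proof.
move=> hd [dhd <-] hmax; rewrite leNgt; apply/negP => d2h_gt0.
have dh0 := derivative0_at_local_max hd hmax.
have : \forall t \near 0^', 0 < t^-1 *: ((dh \o shift 0) (t *: 1) - dh 0).
  exact: cvgr_gt dhd _ d2h_gt0.
move=> /nbhs_ballP[r /= r0 Hr].
have /nbhs_ballP[e /= e0 He] :
    nbhs (0 : R) [set t | is_derive t (1 : R) h (dh t) /\ h t <= h 0].
  exact: filterI hd hmax.
(* Half the smaller radius, so that the closed interval from 0 to [b] lies both where the difference
   quotient of [dh] is positive and where [h] is differentiable with maximum [h 0]. *)
pose b := Num.min r e / 2.
have m0 : 0 < Num.min r e by rewrite lt_min r0.
have b0 : 0 < b by rewrite divr_gt0.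
have bm : b < Num.min r e by rewrite ltr_pdivrMr// ltr_pMr// ltr1n.
have inb t : 0 <= t -> t <= b -> ball 0 r t /\ ball 0 e t.
  move=> t0 tb; rewrite /ball /= sub0r normrN ger0_norm//; split;
    apply: (le_lt_trans tb); apply: (lt_le_trans bm); by rewrite ge_min lexx ?orbT.
have dhb t : 0 <= t -> t <= b -> is_derive t 1 h (dh t).
  by move=> t0 tb; exact: (He _ (inb _ t0 tb).2).1.
have [|||c cb hb] := @MVT _ h dh 0 b.
- exact: b0.
- by move=> t; rewrite in_itv /= => /andP[t0 tb]; apply: dhb; exact: ltW.
- apply: derivable_within_continuous => t; rewrite in_itv /= => /andP[t0 tb].
  by have [] := dhb _ t0 tb.
move: cb; rewrite in_itv /= => /andP[c0 cb].
have dc : 0 < dh c.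
  have := Hr c (inb _ (ltW c0) (ltW cb)).1; rewrite gt_eqF//= => /(_ isT).
  by rewrite dh0 subr0 addr0 /GRing.scale /= mulr1 pmulr_rgt0 ?invr_gt0.
have := (He _ (inb _ (ltW b0) (lexx _)).2).2.
by rewrite -subr_le0 hb subr0 leNgt mulr_gt0.
Qed.

(** * Restriction to lines and partial derivatives at a maximum *)

(** No chain rule is involved: both derivatives are limits of the same difference quotient. *)
Lemma is_derive_line (R : realType) n (h : 'rV[R]_n -> R) x v t :
  differentiable h (t *: v + x) ->
  is_derive t 1 (fun s : R => h (s *: v + x)) ('D_v h (t *: v + x)).
Proof.
move=> /diff_derivable-/(_ v) dh.
have E : (fun s : R => s^-1 *: (((fun r : R => h (r *: v + x)) \o shift t) (s *: 1)
      - h (t *: v + x))) =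
    (fun s : R => s^-1 *: ((h \o shift (t *: v + x)) (s *: v) - h (t *: v + x))).
  by apply/funext => s /=; rewrite [s *: 1]mulr1 scalerDl addrA.
by split; rewrite /derivable /derive E.
Qed.

Lemma derive_partials (R : realType) n (h : 'rV[R]_n -> R) x v :
  differentiable h x -> 'D_v h x = \sum_a v 0 a * partial a h x.
Proof.
move=> dh; rewrite deriveE// {1}(row_sum_delta v) linear_sum.
by apply: eq_bigr => a _; rewrite linearZ /= /partial deriveE.
Qed.

Lemma near_line (R : realType) n (x v : 'rV[R]_n) (P : set 'rV[R]_n) :
  (\forall y \near x, P y) -> \forall t \near (0 : R), P (t *: v + x).
Proof.
move=> Px; have : {for (0 : R), continuous (fun t : R => t *: v + x)}.
  by apply: cvgD; [exact: scalel_continuous | exact: cvg_cst].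
by apply; rewrite scale0r add0r.
Qed.

Section LocalMaximum.
Context {R : realType} {n : nat}.
Variables (U : set 'rV[R]_n) (h : 'rV[R]_n -> R) (x : 'rV[R]_n).
Hypotheses (oU : open U) (Ux : U x) (hmax : forall y, U y -> h y <= h x).

Lemma near_U : \forall y \near x, U y. Proof. exact: open_nbhs_nbhs. Qed.

Lemma line_max v : \forall t \near (0 : R), h (t *: v + x) <= h (0 *: v + x).
Proof.
by rewrite scale0r add0r; apply: near_line (filterS hmax near_U).
Qed.

Lemma near_is_derive_line v : (forall y, U y -> differentiable h y) ->
  \forall t \near (0 : R),
    is_derive t (1 : R) (fun s : R => h (s *: v + x)) ('D_v h (t *: v + x)).
Proof.
move=> dh; near=> t; have Ut : U (t *: v + x).
  by near: t; apply: near_line; exact: near_U.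
exact: is_derive_line (dh _ Ut).
Unshelve. all: by end_near. Qed.

Lemma partial0_at_max a : diff_upto 0 U h -> partial a h x = 0.
Proof.
move=> [dh _].
have := derivative0_at_local_max (near_is_derive_line (delta_mx 0 a) dh) (line_max _).
by rewrite scale0r add0r.
Qed.

(** Second derivative test on the line [t *: v + x]. The first derivative there is expanded in
    partials, each of which is differentiated once more. *)
Lemma second_partials_le0_at_max (v : 'rV[R]_n) : diff_upto 1 U h ->
  \sum_b v 0 b * \sum_a v 0 a * partial a (partial b h) x <= 0.
Proof.
move=> [dh ddh].
apply: (@second_derivative_le0_at_local_max _ (fun t => h (t *: v + x))
  (fun t => \sum_b v 0 b * partial b h (t *: v + x)) _ _ _ (line_max v)).
  near=> t; have Ut : U (t *: v + x).
    by near: t; apply: near_line; exact: near_U.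
  by rewrite -derive_partials; [exact: is_derive_line (dh _ Ut)|exact: dh].
have -> : (fun t => \sum_b v 0 b * partial b h (t *: v + x)) =
    \sum_b (v 0 b \*: (fun t : R => partial b h (t *: v + x)) : R -> R).
  by apply/funext => t; rewrite fct_sumE.
apply: is_derive_sum => b; apply: is_deriveZ.
have [dbh _] := ddh b.
rewrite -derive_partials; last exact: dbh.
have := @is_derive_line _ _ (partial b h) x v 0.
by rewrite scale0r add0r; apply; exact: dbh.
Unshelve. all: by end_near. Qed.

End LocalMaximum.

(** * Positive definite matrices and traces *)

(** Completing the square, by induction on the size; the [P] obtained is lower triangular, the
    inverse of the Cholesky factor of [G]. *)
Lemma posdef_congruent1 (R : rcfType) n (G : 'M[R]_n) : G^T = G ->
  (forall v : 'rV_n, v != 0 -> 0 < (v *m G *m v^T) 0 0) ->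
  exists P : 'M[R]_n, P *m G *m P^T = 1%:M.
Proof.
elim: n G => [|n IHn]; first by exists 1%:M; apply/matrixP => -[].
rewrite -[n.+1]/(1 + n)%N => G.
rewrite -[G](@submxK _ 1 n 1 n) tr_block_mx [ulsubmx G]mx11_scalar.
set a := ulsubmx G 0 0; set b := ursubmx G; set D := drsubmx G.
move=> /eq_block_mx[_ _ cb Dsym]; rewrite -{}cb => Gpos.
have qf (x : 'M[R]_1) (w : 'rV_n) : row_mx x w *m block_mx a%:M b b^T D *m (row_mx x w)^T =
    a *: x *m x^T + w *m b^T *m x^T + x *m b *m w^T + w *m D *m w^T.
  rewrite tr_row_mx mul_row_block mul_row_col !mulmxDl mul_mx_scalar.
  by rewrite !addrA.
have a0 : 0 < a.
  have := Gpos (row_mx 1%:M 0); rewrite qf !mul0mx !addr0 trmx0 mulmx0 addr0.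
  rewrite trmx1 mulmx1 !mxE eqxx mulr1; apply.
  by apply/eqP => /(congr1 lsubmx)/matrixP/(_ 0 0)/eqP; rewrite row_mxKl !mxE oner_eq0.
(* Schur complement of the pivot [a]; it is again symmetric and positive definite. *)
pose S := D - a^-1 *: (b^T *m b).
have Ssym : S^T = S by rewrite /S linearB linearZ /= trmx_mul trmxK Dsym.
have [|P HP] := IHn S Ssym.
  (* For fixed [w] this first coordinate minimises the form of [G], and the minimum is the form of
     [S] at [w]. *)
  move=> w w0; have := Gpos (row_mx (- (a^-1 *: (w *m b^T))) w).
  rewrite qf; set x := - _; rewrite (_ : _ + _ + _ + _ = w *m S *m w^T).
    apply; apply: contra_neq w0 => /(congr1 rsubmx).
    by rewrite row_mxKr linear0.
  rewrite /x scalerN scalerA divff ?gt_eqF// scale1r mulNmx addNr add0r.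
  by rewrite !mulNmx -!scalemxAl addrC /S mulmxBr mulmxBl -scalemxAr -scalemxAl !mulmxA.
(* [s] normalises the pivot to 1; [y] clears the off-diagonal block, leaving [P *m S] in the lower
   right corner. *)
pose s := (Num.sqrt a)^-1; pose y := - (a^-1 *: (P *m b^T)).
have yE : y *m a%:M + P *m b^T = 0.
  by rewrite mul_mx_scalar /y scalerN scalerA divff ?gt_eqF// scale1r addNr.
have yS : y *m b + P *m D = P *m S.
  by rewrite /y mulNmx -scalemxAl addrC /S mulmxBr -scalemxAr mulmxA.
have yE' : a%:M *m y^T + b *m P^T = 0.
  by have := congr1 trmx yE; rewrite trmx0 linearD /= !trmx_mul trmxK tr_scalar_mx.
exists (block_mx s%:M 0 y P).
rewrite tr_block_mx trmx0 !mulmx_block tr_scalar_mx !mul0mx !mulmx0 !addr0.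
rewrite yE yS HP !mul0mx add0r -!(mulmxA s%:M) -mulmxDr yE' mulmx0.
rewrite -!scalar_mxM mulrCA -expr2 exprVn sqr_sqrtr ?ltW// mulfV ?gt_eqF//.
by rewrite -scalar_mx_block.
Qed.

(** With [P] as above, [invmx G = P^T *m P], so the trace is that of [P *m H *m P^T]. Its diagonal
    entries are the values of the form [H] on the rows of [P], a [G]-orthonormal basis. *)
Lemma mxtrace_posdef_seminegative (R : rcfType) n (G H : 'M[R]_n) : G^T = G ->
  (forall v : 'rV_n, v != 0 -> 0 < (v *m G *m v^T) 0 0) ->
  (forall v : 'rV_n, (v *m H *m v^T) 0 0 <= 0) ->
  \tr (invmx G *m H) <= 0.
Proof.
move=> Gsym Gpos Hneg; have [P HP] := posdef_congruent1 Gsym Gpos.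
have [uPG uPT] := mulmx1_unit HP.
have uP : P \in unitmx by rewrite -unitmx_tr.
have -> : invmx G = P^T *m P.
  have uG : G \in unitmx by move: uPG; rewrite unitmx_mul uP.
  by apply: (can_inj (mulKmx uG)); rewrite mulmxV// mulmxA; apply: (can_inj (mulKmx uP));
    rewrite mulmx1 !mulmxA HP mul1mx.
rewrite -mulmxA mxtrace_mulC; apply: sumr_le0 => i _.
suff -> : (P *m H *m P^T) i i = (row i P *m H *m (row i P)^T) 0 0 by exact: Hneg.
rewrite -row_mul mxE [RHS]mxE.
by apply: eq_bigr => j _; rewrite [X in _ = X * _]mxE [X in _ * X]mxE [X in _ = _ * X]mxE [X in _ = _ * X]mxE.
Qed.

(** * Change of sign, reducing minima to maxima *)

(* Unconditional because a non-existing directional derivative is 0. *)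
Lemma deriveN_total (R : realType) (V : normedModType R) (h : V -> R) x v :
  'D_v (- h) x = - 'D_v h x.
Proof.
have [dh|ndh] := pselect (derivable h x v); first exact: deriveN.
have ndN : ~ derivable (- h) x v by move=> /derivableN; rewrite opprK.
rewrite /derive [in RHS](dvgP ndh) [LHS](dvgP ndN).
by rewrite (_ : point = 0 :> R)// oppr0.
Qed.

(** The induction replaces [partial a (- h)] as a function on the whole space, also outside [U],
    hence the appeal to [deriveN_total]. *)
Lemma diff_uptoN (R : realType) n k (U : set 'rV[R]_n) (h : 'rV[R]_n -> R) :
  diff_upto k U h -> diff_upto k U (- h).
Proof.
elim: k h => [|k IHk] h [dh dk];
  (split; first by move=> x /dh; exact: differentiableN) => // a.
rewrite (_ : partial a (- h) = - partial a h); first exact/IHk/dk.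
by apply/funext => x; rewrite /partial deriveN_total.
Qed.

(** * The Hessian and its trace on a manifold *)

Section Manifold.
Context {R : realType} {n : nat} {M : manifold R n}.
Implicit Types (u : M -> R) (i : chart_idx M) (p : M).

(** Near [p], [u] equals its chart expression composed with [coords], and both factors are
    continuous. *)
Lemma smooth_fun_continuous u : smooth_fun u -> continuous u.
Proof.
move=> su p; have [i dp] := atlas_cover p.
have hc : {for coords (atlas i) p, continuous (u \o param (atlas i))}.
  by apply: differentiable_continuous; apply: (su i 0%N).1; exists p.
have ec : \forall q \near p, (u \o param (atlas i)) (coords (atlas i) q) = u q.
  have : nbhs p (dom (atlas i)).
    by apply: open_nbhs_nbhs; split => //; exact: dom_open.
  by apply: filterS => q dq /=; rewrite coordsK.
have cc : {for p, continuous ((u \o param (atlas i)) \o coords (atlas i))}.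
  by apply: continuous_comp hc; exact: coords_cont.
rewrite /continuous_at -(nbhs_singleton ec).
by apply: cvg_trans cc; exact: near_eq_cvg.
Qed.

Lemma smooth_funN u : smooth_fun u -> smooth_fun (- u).
Proof. by move=> su i k; exact: (diff_uptoN (su i k)). Qed.

Lemma pdN i a u : pd i a (- u) = - pd i a u.
Proof. by apply/funext => p; exact: (deriveN_total (u \o param (atlas i))). Qed.

Lemma hessianN (g : tensor2 M) u i p : hessian g (- u) i p = - hessian g u i p.
Proof.
apply/matrixP => a b; rewrite !mxE pdN pdN fctE opprD; congr (_ + _).
by rewrite -!sumrN; apply: eq_bigr => k _; rewrite pdN fctE mulrN.
Qed.

(** In coordinates, [pd i b u] is known to be the partial derivative of the chart expression only on
    the chart image; this set is open, so the next derivative agrees as well. *)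
Lemma pd_pd i a b u p : dom (atlas i) p ->
  pd i a (pd i b u) p =
    partial a (partial b (u \o param (atlas i))) (coords (atlas i) p).
Proof.
move=> dp; rewrite /pd /partial; apply: near_eq_derive.
have : nbhs (coords (atlas i) p) (coords (atlas i) @` dom (atlas i)).
  by apply: open_nbhs_nbhs; split; [exact: codom_open|exists p].
by apply: filterS => _ [q dq <-] /=; rewrite coordsK.
Qed.

Lemma mxtrace_hessian_le0_at_max (g : tensor2 M) u i p :
  riemannian g -> smooth_fun u -> dom (atlas i) p -> (forall q, u q <= u p) ->
  \tr (invmx (g i p) *m hessian g u i p) <= 0.
Proof.
move=> [g_pr g_pos] su dp pmax.
pose x := coords (atlas i) p; pose U := coords (atlas i) @` dom (atlas i).
have Ux : U x by exists p.
have hmax y : U y -> (u \o param (atlas i)) y <= (u \o param (atlas i)) x.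
  by move=> _; rewrite /= /x coordsK.
have oU : open U by exact: codom_open.
have grad0 a : pd i a u p = 0 by exact: (partial0_at_max oU Ux hmax a (su i 0%N)).
apply: mxtrace_posdef_seminegative; first exact: (Defs.metric_sym g_pr dp).
  exact: g_pos dp.
(* The form of the Hessian at [v] is the double sum of second partials of the chart expression: each
   Christoffel symbol is multiplied by a component of the gradient, which is zero by [grad0]. *)
move=> v; have := second_partials_le0_at_max oU Ux hmax v (su i 1%N).
congr (_ <= _); rewrite [RHS]mxE; apply: eq_bigr => b _.
rewrite [(v^T) _ _]mxE mulrC; congr (_ * _); rewrite mxE; apply: eq_bigr => a _.
congr (_ * _); rewrite mxE pd_pd// big1 ?subr0// => k _.
by rewrite grad0 mulr0.
Qed.

(** Under the trace the Ricci term becomes [scal] and the metric contributes the trace of the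
    identity, [n]. *)
Lemma mxtrace_hessian_soliton (g : tensor2 M) u lambda rho i p :
  riemannian g -> gradient_almost_RB_soliton g u lambda rho ->
  dom (atlas i) p ->
  \tr (invmx (g i p) *m hessian g u i p) =
    n%:R * lambda p - (1 - n%:R * rho) * scal g i p.
Proof.
move=> [g_pr _] sol dp.
have := congr1 (fun A => \tr (invmx (g i p) *m A)) (soliton_eq sol dp).
rewrite /= mulmxDr mxtraceD -scalemxAr mulVmx; last exact: (metric_nondegenerate g_pr dp).
rewrite mxtraceZ mxtrace1 => /(canRL (addKr _)) ->.
by rewrite -/(scal g i p); ring.
Qed.

Lemma smooth_fun_has_max u : compact [set: M] -> smooth_fun u ->
  exists p, forall q, u q <= u p.
Proof.
move=> cM /smooth_fun_continuous cu.
have [|p _ pmax] := compact_EVT_max (manifold_nonempty M) cM (f := u).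
  exact: continuous_subspaceT.
by exists p => q; apply: pmax; rewrite inE.
Qed.

End Manifold.

(** * Exclusion of the two sign patterns *)

Theorem theorem6p1 (R : realType) (n1 n2 : nat)
    (M1 : manifold R n1) (M2 : manifold R n2)
    (g1 : tensor2 M1) (g2 : tensor2 M2)
    (f phi u lambda : prod_manifold M1 M2 -> R) (rho : R)
    (o : chart_idx (prod_manifold M1 M2) -> prod_manifold M1 M2 -> bool) :
  let n := (n1 + n2)%N in
  let M := prod_manifold M1 M2 in
  let gL := lyra_metric g1 g2 f phi in
  (0 < n1)%N -> (0 < n2)%N ->
  pseudo_riemannian g1 -> pseudo_riemannian g2 ->
  smooth_fun f -> (forall p : M, 0 < f p) ->
  smooth_fun phi -> (forall p : M, 0 < phi p) ->
  compact [set: M] -> connected [set: M] -> orientation o ->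
  riemannian gL ->
  gradient_almost_RB_soliton gL u lambda rho ->
  ~ ((forall i (p : M), dom (atlas i) p ->
        (1 - n%:R * rho) * scal gL i p <= 0) /\
     (forall p : M, 0 < lambda p)) /\
  ~ ((forall i (p : M), dom (atlas i) p ->
        0 <= (1 - n%:R * rho) * scal gL i p) /\
     (forall p : M, lambda p < 0)).
Proof.
move=> n M gL n1_gt0 _ _ _ _ _ _ _ cM _ _ gR sol.
have n_gt0 : 0 < n%:R :> R by rewrite ltr0n addn_gt0 n1_gt0.
have su := potential_smooth sol.
split=> -[scal_sign lambda_sign].
  have [p pmax] := smooth_fun_has_max cM su.
  have [i dp] := atlas_cover p.
  (* At the maximum, [n%:R * lambda p] would be at most [(1 - n%:R * rho) * scal gL i p], hence at
     most 0, although it is positive. *)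
  have := mxtrace_hessian_le0_at_max gR su dp pmax.
  rewrite (mxtrace_hessian_soliton gR sol dp) subr_le0 leNgt.
  by rewrite (le_lt_trans (scal_sign _ _ dp))// mulr_gt0.
(* A maximum of [- u] is a minimum of [u]; there the same estimate bounds the trace of the Hessian
   of [u] from below by 0. *)
have [p pmin] := smooth_fun_has_max cM (smooth_funN su).
have [i dp] := atlas_cover p.
have := mxtrace_hessian_le0_at_max gR (smooth_funN su) dp pmin.
rewrite hessianN mulmxN linearN oppr_le0 /= (mxtrace_hessian_soliton gR sol dp).
rewrite subr_ge0 leNgt (lt_le_trans _ (scal_sign _ _ dp))//.
by rewrite pmulr_rlt0.
Qed.
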